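(* Let $\mathcal{F}$ be the class of all closeness classes of ls-continuous maps whose domain is a monogenic ls-space. Then an ls-continuous map $f: X \rightarrow Y$ between ls-spaces is coarsely monotone if and only if it is stably in $\mathcal{E}_I$ with respect to $\mathcal{F}$, where $I$ is the reflection of the coarse category onto the full subcategory of ls-spaces of asymptotic dimension $0$.
   Context: For families $\mathcal{B},\mathcal{U}$ of subsets of a set $X$, $\mathrm{st}(B,\mathcal{U})$ is the union of the elements of $\mathcal{U}$ that intersect $B\subseteq X$, and $\mathrm{st}(\mathcal{B},\mathcal{U})=\{\mathrm{st}(B,\mathcal{U})\mid B\in\mathcal{B}\}$. A large scale structure (ls-structure) on $X$ is a nonempty set $\mathcal{L}$ of families of subsets of $X$ (the uniformly bounded families) such that (1) if $\mathcal{B}_1\in\mathcal{L}$ and each element of $\mathcal{B}_2$ with more than one point is contained in an element of $\mathcal{B}_1$, then $\mathcal{B}_2\in\mathcal{L}$; (2) $\mathcal{B}_1,\mathcal{B}_2\in\mathcal{L}$ implies $\mathrm{st}(\mathcal{B}_1,\mathcal{B}_2)\in\mathcal{L}$. An ls-space is a set with an ls-structure; it is monogenic if its ls-structure is generated by a single family of subsets (i.e. is the smallest ls-structure containing that family). A map $f:X\to Y$ of ls-spaces is ls-continuous if $f(\mathcal{U})=\{f(U)\mid U\in\mathcal{U}\}$ is uniformly bounded for every uniformly bounded $\mathcal{U}$. Maps $f,g:X\to Y$ are close if $\{\{f(x),g(x)\}\mid x\in X\}$ is uniformly bounded. An ls-continuous map $f$ is a coarse equivalence if it has an ls-continuous inverse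 up to closeness. The coarse category has ls-spaces as objects and closeness classes of ls-continuous maps as morphisms. For a family $\mathcal{U}$ of subsets of $X$ and $A\subseteq X$, the $\mathcal{U}$-components of $A$ are the equivalence classes of the relation on $A$: $x,x'$ are joined by a finite sequence $x=x_1,\dots,x_k=x'$ in $A$ such that each pair $x_i,x_{i+1}$ lies in a common element of $\mathcal{U}$. For ls-continuous $f:X\to Y$ and uniformly bounded $\mathcal{U}$ in $X$, $\mathcal{V}$ in $Y$, $c(\mathcal{U},f,\mathcal{V})$ is the family of all $\mathcal{U}$-components of sets $f^{-1}(V)$, $V\in\mathcal{V}$. The light structure on $X$ with respect to $f$ is the closure under refinement of the set of all $c(\mathcal{U},f,\mathcal{V})$ (all families each of whose elements with more than one point is contained in an element of one fixed $c(\mathcal{U},f,\mathcal{V})$); it is an ls-structure. $X_f$ denotes the set $X$ with this structure. The map $f$ is coarsely monotone if $f$, regarded as a map $X_f\to Y$, is a coarse equivalence. An ls-space $X$ has asymptotic dimension $0$ iff for every uniformly bounded family $\mathcal{U}$ in $X$ the $\mathcal{U}$-components of $X$ form a uniformly bounded family. For an ls-space $X$, $I(X)$ is the same set with the ls-structure of all families that refine the set of $\mathcal{U}$-components of $X$ for some uniformly bounded $\mathcal{U}$ in $X$. This gives a reflection $I$ of the coarse category onto the full subcategory of ls-spaces of asymptotic dimension $0$; for $f:X\to Y$, $I(f):I(X)\to I(Y)$ equals $f$ as a set map. $\mathcal{E}_I$ is the class of (closeness classes of) ls-continuous maps $f$ such that $I(f)$ is a coarse equivalence. For a class $\mathcal{F}$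 of morphisms of the coarse category, a morphism $f:X\to Y$ in $\mathcal{E}_I$ is stably in $\mathcal{E}_I$ with respect to $\mathcal{F}$ if for every $j:Z\to Y$ in $\mathcal{F}$ the following holds: for all morphisms $i:W\to X$, $g:W\to Z$ of the coarse category with $fi=jg$ there exist an object $P$ and morphisms $d:W\to P$, $e:P\to Z$, $c:P\to X$ with $e\in\mathcal{E}_I$, $je=fc$, $ed=g$, $cd=i$ (all equalities in the coarse category, i.e. up to closeness of representatives). *)

(* Defs.v *)
From mathcomp Require Import all_boot zify.
From mathcomp Require Import boolp classical_sets.
Set Implicit Arguments.
Unset Strict Implicit.
Unset Printing Implicit Defensive.
Local Open Scope classical_set_scope.

Section Families.
Variable X : Type.
Implicit Types (A : set X) (U : set (set X)).

Definition star (B : set X) U : set X := \bigcup_(A in [set A | U A /\ A `&` B !=set0]) A.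

Definition star_family (Bs U : set (set X)) : set (set X) :=
  [set star B U | B in Bs].

Definition more_than_one_point (B : set X) : Prop := exists x y, [/\ B x, B y & x <> y].

(* Refinement ignores the elements with at most one point: this is the form
   occurring in axiom (1) of an ls-structure. *)
Definition refines (B2 B1 : set (set X)) : Prop :=
  forall B, B2 B -> more_than_one_point B -> exists2 A, B1 A & B `<=` A.

Definition is_ls_structure (L : set (set (set X))) : Prop :=
  [/\ L !=set0,
      forall B1 B2 : set (set X), L B1 -> refines B2 B1 -> L B2 &
      forall B1 B2 : set (set X), L B1 -> L B2 -> L (star_family B1 B2)].

Definition chained U A (x y : X) : Prop :=
  exists (n : nat) (p : nat -> X),
    [/\ p 0 = x, p n = y,
        forall i, i <= n -> A (p i) &
        forall i, i < n -> exists2 u, U u & u (p i) /\ u (p i.+1)].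

Definition component U A x : set X := [set y | chained U A x y].

Definition components U A : set (set X) := [set component U A x | x in A].

Lemma chained_refl U A x : A x -> chained U A x x.
Proof. by move=> Ax; exists 0, (fun=> x); split. Qed.

Lemma chained_sym U A x y : chained U A x y -> chained U A y x.
Proof.
move=> [n [p [p0 pn pA pU]]]; exists n, (fun i => p (n - i)); split.
- by rewrite subn0.
- by rewrite subnn.
- by move=> i _; apply: pA; rewrite leq_subr.
- move=> i lin; have /pU[u Uu [u1 u2]] : n - i.+1 < n by lia.
  by exists u => //; split => //; rewrite (_ : n - i = (n - i.+1).+1) //; lia.
Qed.

Lemma chained_trans U A y x z :
  chained U A x y -> chained U A y z -> chained U A x z.
Proof.
move=> [n [p [p0 pn pA pU]]] [m [q [q0 qm qA qU]]].
exists (n + m), (fun i => if i <= n then p i else q (i - n)); split => //.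
- case: leqP => [le|_]; last by rewrite addKn.
  have m0 : m = 0 by lia.
  by rewrite m0 addn0 pn -q0 -qm m0.
- by move=> i le; case: leqP => [/pA//|lt]; apply: qA; lia.
- move=> i lt; case: (ltngtP i n) => [lin|lni|ein].
  + exact: pU.
  + have /qU : i - n < m by lia.
    by rewrite subSn // ltnW.
  + have /qU : 0 < m by lia.
    by rewrite ein subSnn q0 pn.
Qed.

Lemma chained_mono U U' A A' x y : U `<=` U' -> A `<=` A' ->
  chained U A x y -> chained U' A' x y.
Proof.
move=> UU' AA' [n [p [p0 pn pA pU]]]; exists n, p; split=> // i lin.
  exact/AA'/pA.
by have [u Uu up] := pU i lin; exists u => //; exact: UU'.
Qed.

Lemma chained_in U A x y : chained U A x y -> A x /\ A y.
Proof. by move=> [n [p [<- <- pA _]]]; split; exact: pA. Qed.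

Lemma refines_trans B3 B2 B1 :
  refines B3 B2 -> refines B2 B1 -> refines B3 B1.
Proof.
move=> r32 r21 B B3B [x [y [Bx By xy]]].
have [|A B2A BA] := r32 _ B3B; first by exists x, y.
have [|C B1C AC] := r21 _ B2A; first by exists x, y; split => //; exact: BA.
by exists C => // z /BA/AC.
Qed.

Definition with_points U : set (set X) := U `|` range (@set1 X).

Variables (L : set (set (set X))) (lsL : is_ls_structure L).

Lemma ls_with_points U : L U -> L (with_points U).
Proof.
case: lsL => _ ax1 _ LU; apply: ax1 LU _ => B [UB _|[x _ <-]].
  by exists B.
by move=> [y [z [-> ->]]].
Qed.

Lemma ls_union U1 U2 : L U1 -> L U2 -> L (U1 `|` U2).
Proof.
move=> /ls_with_points L1 /ls_with_points L2; case: lsL => _ ax1 ax2.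
apply: ax1 (ax2 _ _ L1 L2) _ => B UB [x [_ [Bx _ _]]].
case: UB => UB.
- exists (star B (with_points U2)); first by exists B => //; left.
  by move=> z Bz; exists [set z] => //=; split; [right; exists z|exists z].
- exists (star [set x] (with_points U2)).
    by exists [set x] => //; right; exists x.
  by move=> z Bz; exists B => //=; split; [left|exists x].
Qed.

End Families.

Record lsSpace := LsSpace {
  ls_carrier :> Type;
  unif_bounded : set (set (set ls_carrier));
  unif_bounded_ls : is_ls_structure unif_bounded }.

Definition monogenic (X : lsSpace) : Prop :=
  exists G : set (set X),
    unif_bounded G /\
    forall L : set (set (set X)),
      is_ls_structure L -> L G -> @unif_bounded X `<=` L.

Definition ls_continuous (X Y : lsSpace) (f : X -> Y) : Prop :=
  forall U : set (set X), unif_bounded U -> unif_bounded [set f @` A | A in U].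

Definition close (X : Type) (Y : lsSpace) (f g : X -> Y) : Prop :=
  unif_bounded [set [set f x; g x] | x in [set: X]].

Definition coarse_equivalence (X Y : lsSpace) (f : X -> Y) : Prop :=
  ls_continuous f /\
  exists g : Y -> X,
    [/\ ls_continuous g, close (g \o f) (@id X) & close (f \o g) (@id Y)].

(* A morphism of the coarse category is given by a representative; equality of
   morphisms is [close]. *)
Record lsMap (X Y : lsSpace) := LsMap {
  ls_fun :> X -> Y;
  ls_fun_continuous : ls_continuous ls_fun }.

Section LightStructure.
Variables (X Y : Type) (f : X -> Y).

Definition component_preimages (U : set (set X)) (V : set (set Y)) :
    set (set X) :=
  \bigcup_(v in V) components U (f @^-1` v).

Definition light_structure (L : set (set (set X))) (M : set (set (set Y))) :
    set (set (set X)) :=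
  [set B | exists U V, [/\ L U, M V & refines B (component_preimages U V)]].

Lemma refines_preimages U V Bs B a :
  refines Bs (component_preimages U V) -> Bs B -> B a ->
  exists2 w, with_points V w &
    forall x y, B x -> B y -> chained U (f @^-1` w) x y.
Proof.
move=> rB BsB Ba; case: (pselect (more_than_one_point B)) => [m1|nm1].
  have [_ [v Vv [z _ <-]] Bz] := rB _ BsB m1; exists v; first by left.
  move=> x y /Bz /= zx /Bz /= zy; apply: chained_trans zy.
  exact: chained_sym.
exists [set f a]; first by right; exists (f a).
have Ea x : B x -> x = a.
  by move=> Bx; apply: contrapT => xa; apply: nm1; exists x, a.
by move=> x y /Ea -> /Ea ->; exact: chained_refl.
Qed.

Lemma light_structure_ls L M : is_ls_structure L -> is_ls_structure M ->
  is_ls_structure (light_structure L M).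
Proof.
move=> lsL lsM; split.
- have [[U LU] _ _] := lsL; have [[V MV] _ _] := lsM.
  by exists set0, U, V; split.
- move=> B1 B2 [U [V [LU MV r]]] r21; exists U, V; split=> //.
  exact: refines_trans r21 r.
- move=> B1 B2 [U1 [V1 [LU1 MV1 r1]]] [U2 [V2 [LU2 MV2 r2]]].
  exists (U1 `|` U2), (star_family (with_points V1) (with_points V2)).
  split; first exact: ls_union.
    by have [_ _ ax2] := lsM; apply: ax2; exact: ls_with_points.
  move=> _ [B B1B <-] [p [_ [[D [B2D [a [Da Ba]]] Dp] _ _]]].
  have [w V1w Bw] := refines_preimages r1 B1B Ba.
  set S := star w (with_points V2).
  have wS : w `<=` S.
    by move=> y wy; exists [set y] => //=; split; [right; exists y|exists y].
  have key q : star B B2 q -> chained (U1 `|` U2) (f @^-1` S) a q.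
    move=> [E [B2E [b [Eb Bb]]] Eq].
    have [v V2v Ev] := refines_preimages r2 B2E Eb.
    apply: (@chained_trans _ _ _ b).
      apply: chained_mono (Bw _ _ Ba Bb); first exact: subsetUl.
      exact: preimage_subset.
    apply: chained_mono (Ev _ _ Eb Eq); first exact: subsetUr.
    apply: preimage_subset => y vy; exists v => //=; split=> //.
    exists (f b); split; first by have [] := chained_in (Ev _ _ Eb Eq).
    by have [] := chained_in (Bw _ _ Bb Bb).
  exists (component (U1 `|` U2) (f @^-1` S) a); last exact: key.
  exists S; first by exists w.
  exists a => //; apply: wS.
  by have [] := chained_in (Bw _ _ Ba Ba).
Qed.

End LightStructure.

Definition light_space (X Y : lsSpace) (f : lsMap X Y) : lsSpace :=
  LsSpace (light_structure_ls f (unif_bounded_ls X) (unif_bounded_ls Y)).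

Definition coarsely_monotone (X Y : lsSpace) (f : lsMap X Y) : Prop :=
  @coarse_equivalence (light_space f) Y f.

Definition asdim0 (X : lsSpace) : Prop :=
  forall U : set (set X), unif_bounded U -> unif_bounded (components U setT).

Definition I_structure (X : lsSpace) : set (set (set X)) :=
  [set B | exists2 U, unif_bounded U & refines B (components U setT)].

Lemma I_structure_ls X : is_ls_structure (@I_structure X).
Proof.
suff -> : @I_structure X =
    light_structure (fun=> tt) (@unif_bounded X) [set: set (set unit)].
  apply: light_structure_ls; first exact: unif_bounded_ls.
  by split=> //; exists set0.
apply/seteqP; split=> [B [U LU r]|B [U [V [LU _ r]]]].
  exists U, [set setT]; split=> //; apply: refines_trans r _ => A UA _.
  by exists A => //; exists setT.
exists U => //; apply: refines_trans r _ => _ [v _ [x _ <-]] _.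
exists (component U setT x); first by exists x.
by move=> y; apply: chained_mono.
Qed.

Definition I_space (X : lsSpace) : lsSpace := LsSpace (@I_structure_ls X).

Lemma chained_image (X Y : Type) (f : X -> Y) U A x y :
  chained U A x y -> chained [set f @` u | u in U] (f @` A) (f x) (f y).
Proof.
move=> [n [p [<- <- pA pU]]]; exists n, (f \o p); split=> // i lin /=.
  by exists (p i) => //; exact: pA.
have [u Uu [u1 u2]] := pU i lin.
by exists (f @` u); [exists u|split; [exists (p i)|exists (p i.+1)]].
Qed.

(* The next four facts are the reflection property of [I_space]; both the unit
   and the factorization through it are the identity on underlying maps. *)
Lemma I_space_asdim0 X : asdim0 (I_space X).
Proof.
move=> U [U0 bU0 r]; exists U0 => // _ [x _ <-] _.
exists (component U0 setT x); first by exists x.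
move=> _ [n [p [<- <- _ pU]]]; elim: n pU => [|n IH] pU.
  exact: chained_refl.
apply: (@chained_trans _ _ _ (p n)); first by apply: IH => i /ltnW/pU.
have [u Uu [u1 u2]] := pU n (ltnSn n).
case: (pselect (p n = p n.+1)) => [<-|ne]; first exact: chained_refl.
have [|_ [z _ <-] uz] := r _ Uu; first by exists (p n), (p n.+1).
apply: (@chained_trans _ _ _ z); last exact: uz.
exact/chained_sym/uz.
Qed.

Lemma I_unit_continuous X : @ls_continuous X (I_space X) id.
Proof.
move=> U bU; exists U => // _ [A UA <-] [x [_ [[x' Ax' _] _ _]]].
exists (component U setT x'); first by exists x'.
move=> _ [y Ay <-]; exists 1, (fun i => if i is 0 then x' else y).
by split=> // -[|//] _; exists A.
Qed.

Lemma I_factor (X Y : lsSpace) (f : X -> Y) :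
  asdim0 Y -> ls_continuous f -> @ls_continuous (I_space X) Y f.
Proof.
move=> Y0 cf U [U0 bU0 r]; have [_ ax1 _] := unif_bounded_ls Y.
apply: ax1 (Y0 _ (cf _ bU0)) _ => _ [A UA <-].
move=> [_ [_ [[x Ax <-] [y Ay <-] ne]]].
have [|_ [z _ <-] Az] := r _ UA; first by exists x, y; split=> // /(congr1 f).
exists (component [set f @` u | u in U0] setT (f z)); first by exists (f z).
by move=> _ [t /Az zt <-]; apply: chained_mono (chained_image f zt).
Qed.

Lemma I_map_continuous (X Y : lsSpace) (f : X -> Y) :
  ls_continuous f -> @ls_continuous (I_space X) (I_space Y) f.
Proof.
move=> cf; apply: I_factor; first exact: I_space_asdim0.
move=> U /cf /(@I_unit_continuous Y); congr unif_bounded.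
apply/seteqP; split=> [_ [_ [A UA <-] <-]|_ [A UA <-]].
  by exists A => //; rewrite image_id.
by exists (f @` A); [exists A|rewrite image_id].
Qed.

Definition I_map (X Y : lsSpace) (f : lsMap X Y) :
    lsMap (I_space X) (I_space Y) :=
  LsMap (I_map_continuous (@ls_fun_continuous _ _ f)).

Definition in_E_I (X Y : lsSpace) (f : lsMap X Y) : Prop :=
  coarse_equivalence (I_map f).

Definition morphism_class := forall X Y : lsSpace, lsMap X Y -> Prop.

Definition stably_in_E_I (F : morphism_class) (X Y : lsSpace)
    (f : lsMap X Y) : Prop :=
  in_E_I f /\
  forall (Z : lsSpace) (j : lsMap Z Y), F Z Y j ->
  forall (W : lsSpace) (i : lsMap W X) (g : lsMap W Z),
    close (f \o i) (j \o g) ->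
  exists (P : lsSpace) (d : lsMap W P) (e : lsMap P Z) (c : lsMap P X),
    [/\ in_E_I e, close (j \o e) (f \o c), close (e \o d) g &
        close (c \o d) i].

Definition monogenic_domain : morphism_class :=
  fun Z Y (_ : lsMap Z Y) => monogenic Z.

(* Main.v *)
(** Call a map [f : X -> Y] chain-lifting if points of [X] with near images are
    joined by chains of bounded step whose image in [Y] stays bounded.  Then [f]
    is coarsely monotone iff it is coarsely surjective and chain-lifting.

    If [f] is coarsely monotone with inverse [h] and [Z] is generated by [G], let
    [P] consist of the pairs [(x, z)] such that [x] is joined to [h (j z)] by a
    chain of fixed step over a member of a fixed family in [Y].  Such a chain
    remains in [P], so [z |-> (h (j z), z)] inverts the projection [P -> Z] up to
    chains.  A single step and a single family suffice because continuity of the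
    inverse need only be tested on [G].

    Conversely, to lift chains over a uniformly bounded family [V], take for [Z]
    the disjoint union of the members of [V], each being bounded.  A chain in
    [P] then lies over a single member of [V], so that its image in [X] is a
    chain over a bounded subset of [Y]. *)
From mathcomp Require Import all_boot.
From mathcomp Require Import boolp classical_sets.
Require Import Defs.
Set Implicit Arguments.
Unset Strict Implicit.
Unset Printing Implicit Defensive.
Local Open Scope classical_set_scope.

(** * Nearness of points and its use in testing ls-structures *)

Definition near (X : Type) (U : set (set X)) (x y : X) : Prop :=
  exists2 u, U u & u x /\ u y.

Section Near.
Variable X : Type.
Implicit Types (U F : set (set X)) (L : set (set (set X))) (A : set X).

Lemma near_sym U x y : near U x y -> near U y x.
Proof. by move=> [u Uu [ux uy]]; exists u. Qed.

Lemma near_mono U U' x y : U `<=` U' -> near U x y -> near U' x y.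
Proof. by move=> UU' [u Uu uxy]; exists u => //; exact: UU'. Qed.

Lemma near_with_points U x : near (with_points U) x x.
Proof. by exists [set x] => //; right; exists x. Qed.

Lemma sub_with_points U : U `<=` with_points U.
Proof. by move=> u; left. Qed.

Lemma chained_near U A x y : near U x y -> A x -> A y -> chained U A x y.
Proof.
move=> Uxy Ax Ay; exists 1, (fun i => if i is 0 then x else y).
by split=> // -[|i].
Qed.

Lemma chained_ind U A x (Q : X -> Prop) : Q x ->
  (forall y y', chained U A x y -> Q y -> A y' -> near U y y' -> Q y') ->
  forall y, chained U A x y -> Q y.
Proof.
move=> Qx IH y [n [p [p0 <- pA pU]]].
have H i : i <= n -> chained U A x (p i) /\ Q (p i).
  elim: i => [_|i IHi lin].
    by rewrite p0; split=> //; apply: chained_refl; rewrite -p0; exact: pA.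
  have [ch Qi] := IHi (ltnW lin); split; last first.
    by apply: IH ch Qi (pA _ lin) (pU _ lin).
  apply: chained_trans ch _; apply: chained_near (pU _ lin) _ _.
    by apply: pA; exact: ltnW.
  exact: pA.
by have [] := H n (leqnn n).
Qed.

Lemma chained_invariant U A x y : A x ->
  (forall a b, near U a b -> A a -> A b) ->
  chained U setT x y -> chained U A x y.
Proof.
move=> Ax inv; apply: chained_ind; first exact: chained_refl.
move=> a b _ ch _ Uab; have [_ Aa] := chained_in ch.
by apply: chained_trans ch _; apply: chained_near => //; exact: inv Uab Aa.
Qed.

Section Structure.
Variables (L : set (set (set X))) (lsL : is_ls_structure L).

(** Axiom (2) read on points. The singletons added to [U2] keep [x] itself in the star of [u]. *)
Lemma near_trans U1 U2 : L U1 -> L U2 ->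
  exists2 U, L U &
    forall x y z, near U1 x y -> near U2 y z -> near U x z.
Proof.
move=> L1 L2; have [_ _ ax2] := lsL.
exists (star_family U1 (with_points U2)).
  by apply: ax2 => //; exact: ls_with_points.
move=> x y z [u Uu [ux uy]] [w Uw [wy wz]].
exists (star u (with_points U2)); first by exists u.
split; last by exists w => //=; split; [left|exists y].
by exists [set x] => //=; split; [right; exists x|exists x].
Qed.

(** Boundedness can be tested on pairs: a set of pairwise near points lies in the star of any one of
    its points, and singletons form a bounded family. *)
Lemma ls_pairwise U F : L U ->
  (forall B x y, F B -> B x -> B y -> x <> y -> near U x y) -> L F.
Proof.
move=> LU FU; have LU' := ls_with_points lsL LU.
have [_ ax1 ax2] := lsL.
apply: ax1 (ax2 _ _ LU' LU') _ => B FB [a [_ [Ba _ _]]].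
exists (star [set a] (with_points U)).
  by exists [set a] => //; right; exists a.
move=> b Bb; have [u Uu [ua ub]] : near (with_points U) a b.
  case: (pselect (a = b)) => [<-|ab]; first exact: near_with_points.
  by apply: near_mono (FU _ _ _ FB Ba Bb ab); exact: sub_with_points.
by exists u => //=; split=> //; exists a.
Qed.

Lemma ls_set0 : L set0.
Proof. by have [[U LU] ax1 _] := lsL; apply: ax1 LU _ => B. Qed.

(** This is the largest ls-structure on [W] for which [f] is ls-continuous. *)
Lemma preimage_ls (W : Type) (f : W -> X) :
  is_ls_structure [set F : set (set W) | L [set f @` A | A in F]].
Proof.
split.
- exists set0 => /=; apply: ls_pairwise ls_set0 _.
  by move=> B x y [A []].
- move=> F1 F2 /= LF1 r; apply: ls_pairwise LF1 _.
  move=> _ _ _ [A FA <-] [a Aa <-] [b Ab <-] ne.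
  have [|C FC AC] := r _ FA; first by exists a, b; split=> // /(congr1 f).
  by exists (f @` C); [exists C|split; [exists a|exists b] => //; exact: AC].
- move=> F1 F2 /= L1 L2.
  have [U12 LU12 t12] := near_trans L2 L1.
  have [U LU t] := near_trans LU12 L2; apply: ls_pairwise LU _.
  have nearf (F : set (set W)) (A : set W) a b : F A -> A a -> A b ->
      near [set f @` A | A in F] (f a) (f b).
    by move=> FA Aa Ab; exists (f @` A); [exists A|split; [exists a|exists b]].
  move=> _ _ _ [_ [B F1B <-] <-] [a [A [FA [a' [Aa' Ba']] Aa] <-]]
    [b [C [FC [b' [Cb' Bb']] Cb] <-]] _.
  have ab' := t12 _ _ _ (nearf _ _ _ _ FA Aa Aa') (nearf _ _ _ _ F1B Ba' Bb').
  exact: t ab' (nearf _ _ _ _ FC Cb' Cb).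
Qed.

End Structure.

Lemma setI_ls L1 L2 :
  is_ls_structure L1 -> is_ls_structure L2 -> is_ls_structure (L1 `&` L2).
Proof.
move=> ls1 ls2; have [_ r1 s1] := ls1; have [_ r2 s2] := ls2; split.
- by exists set0; split; exact: ls_set0.
- by move=> F1 F2 [? ?] r; split; [exact: r1 r|exact: r2 r].
- by move=> F1 F2 [? ?] [? ?]; split; [exact: s1|exact: s2].
Qed.

(** * Disjoint unions of bounded pieces, the pieces being the fibers of a map *)

Definition fiber_structure (T : Type) (q : X -> T) : set (set (set X)) :=
  [set F | forall x y, near F x y -> q x = q y].

Lemma fiber_structure_ls (T : Type) (q : X -> T) :
  is_ls_structure (fiber_structure q).
Proof.
split.
- by exists set0 => x y [].
- move=> F1 F2 q1 r x y [B FB [Bx By]].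
  case: (pselect (x = y)) => [->//|xy].
  have [|A FA BA] := r _ FB; first by exists x, y.
  by apply: q1; exists A => //; split; exact: BA.
- move=> F1 F2 q1 q2 x y [_ [B FB <-] [[A [FA [a [Aa Ba]] Ax]]]].
  move=> [C [FC [c [Cc Bc]] Cy]].
  have -> : q x = q a by apply: q2; exists A.
  have -> : q a = q c by apply: q1; exists B.
  by apply: q2; exists C.
Qed.

Definition fiber_space (T : Type) (q : X -> T) : lsSpace :=
  LsSpace (fiber_structure_ls q).

Lemma fiber_space_monogenic (T : Type) (q : X -> T) : monogenic (fiber_space q).
Proof.
exists [set [set y | q y = q x] | x in [set: X]]; split.
  by move=> x y [_ [z _ <-] /= [-> ->]].
move=> L lsL LG F FF; apply: ls_pairwise lsL _ _ LG _ => B x y FB Bx By _.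
exists [set z | q z = q x]; first by exists x.
by split=> //=; apply: FF; exists B.
Qed.

End Near.

Lemma near_image (X Y : Type) (f : X -> Y) (U : set (set X)) x y :
  near U x y -> near [set f @` A | A in U] (f x) (f y).
Proof.
move=> [u Uu [ux uy]]; exists (f @` u); first by exists u.
by split; [exists x|exists y].
Qed.

Lemma closeP (X : Type) (Y : lsSpace) (f g : X -> Y) :
  close f g <-> exists2 V, unif_bounded V & forall x, near V (f x) (g x).
Proof.
split=> [cfg|[V bV Vfg]].
  exists [set [set f x; g x] | x in setT] => // x.
  by exists [set f x; g x]; [exists x|split; [left|right]].
apply: (ls_pairwise (unif_bounded_ls Y) bV).
by move=> _ a b [x _ <-] [->|->] [->|->] // _; exact: near_sym.
Qed.

Lemma points_unif_bounded (X : lsSpace) :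
  unif_bounded (with_points (set0 : set (set X))).
Proof. by apply: ls_with_points; [|apply: ls_set0]; exact: unif_bounded_ls. Qed.

Lemma close_refl (X : Type) (Y : lsSpace) (f : X -> Y) : close f f.
Proof.
apply/closeP; exists (with_points set0); first exact: points_unif_bounded.
by move=> x; exact: near_with_points.
Qed.

(** For [q = id] the members of bounded families have at most one point, so the space is
    discrete. *)
Lemma ls_continuous_fiber (X : Type) (Y : lsSpace) (f : X -> Y) :
  @ls_continuous (fiber_space (@id X)) Y f.
Proof.
have lsY := unif_bounded_ls Y.
move=> U bU; apply: (ls_pairwise lsY (ls_set0 lsY)).
move=> _ _ _ [A UA <-] [a Aa <-] [b Ab <-] []; congr f.
by apply: bU; exists A.
Qed.

(** * The reflection in terms of chains *)

Section ISpace.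
Variable X : lsSpace.

Lemma I_structure_chained (F U : set (set X)) : unif_bounded U ->
  (forall B x y, F B -> B x -> B y -> chained U setT x y) ->
  @I_structure X F.
Proof.
move=> bU FU; exists U => // B FB [x [_ [Bx _ _]]].
by exists (component U setT x); [exists x|move=> y By; exact: FU FB _ _].
Qed.

Lemma chained_I_structure (F : set (set X)) : @I_structure X F ->
  exists2 U, unif_bounded U & forall x y, near F x y -> chained U setT x y.
Proof.
move=> [U bU r]; exists U => // x y [B FB [Bx By]].
case: (pselect (x = y)) => [->|xy]; first exact: chained_refl.
have [|_ [z _ <-] Bz] := r _ FB; first by exists x, y.
by apply: (@chained_trans _ _ _ z); [apply: chained_sym; exact: Bz|exact: Bz].
Qed.

Lemma close_I_space (T : Type) (f g : T -> X) (U : set (set X)) :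
  unif_bounded U -> (forall t, chained U setT (f t) (g t)) ->
  @close T (I_space X) f g.
Proof.
move=> bU Ufg; apply: I_structure_chained bU _.
move=> _ a b [t _ <-] [->|->] [->|->]; try exact: chained_refl.
  exact: Ufg.
exact/chained_sym/Ufg.
Qed.

End ISpace.

(** It is enough that [s] is continuous into [I_space P]: this space has asymptotic dimension 0, so
    [s] extends to [I_space Z]. *)
Lemma in_E_I_section (P Z : lsSpace) (e : lsMap P Z) (s : Z -> P)
    (U : set (set P)) :
  @ls_continuous Z (I_space P) s -> close (e \o s) id ->
  unif_bounded U -> (forall p, chained U setT (s (e p)) p) -> in_E_I e.
Proof.
move=> cs /closeP[V bV Ves] bU Use.
split; first exact: (@ls_fun_continuous _ _ (I_map e)).
exists s; split; first exact: I_factor (@I_space_asdim0 P) cs.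
  exact: close_I_space bU _.
by apply: close_I_space bV _ => z; apply: chained_near (Ves z) _ _.
Qed.

(** * Light structures and chain lifting *)

Definition light_near (X Y : Type) (f : X -> Y) (U : set (set X))
    (V : set (set Y)) (x y : X) : Prop :=
  exists2 v, V v & chained U (f @^-1` v) x y.

Section LightNear.
Variables (X Y : Type) (f : X -> Y).
Implicit Types (U : set (set X)) (V : set (set Y)).

Lemma light_near_sym U V x y : light_near f U V x y -> light_near f U V y x.
Proof. by move=> [v Vv ch]; exists v => //; exact: chained_sym. Qed.

Lemma light_near_mono U U' V V' x y : U `<=` U' -> V `<=` V' ->
  light_near f U V x y -> light_near f U' V' x y.
Proof.
move=> UU' VV' [v Vv ch]; exists v; first exact: VV'.
exact: chained_mono ch.
Qed.

Lemma light_nearE U V x y :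
  near (component_preimages f U V) x y <-> light_near f U V x y.
Proof.
split=> [[_ [v Vv [z _ <-]] [zx zy]]|[v Vv ch]].
  exists v => //; apply: (@chained_trans _ _ _ z); last exact: zy.
  exact: chained_sym.
have [vx _] := chained_in ch; exists (component U (f @^-1` v) x).
  by exists v => //; exists x.
by split=> //; exact: chained_refl.
Qed.

Lemma light_near_near U V x y : light_near f U V x y -> near V (f x) (f y).
Proof. by move=> [v Vv ch]; have [vx vy] := chained_in ch; exists v. Qed.

End LightNear.

Definition chain_lifting (X Y : lsSpace) (f : X -> Y) : Prop :=
  forall V, unif_bounded V -> exists U V',
    [/\ unif_bounded U, unif_bounded V' &
      forall x x', near V (f x) (f x') -> light_near f U V' x x'].

Lemma component_preimages_ub (X Y : lsSpace) (f : lsMap X Y) U V :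
  unif_bounded U -> unif_bounded V ->
  @unif_bounded (light_space f) (component_preimages f U V).
Proof. by move=> bU bV; exists U, V; split=> // B VB _; exists B. Qed.

(** If [f x] and [f x'] are near, then x, h (f x), h (f x'), x' are successively near in the light
    structure. Conversely, [h] is not assumed continuous: it sends near points to points with near
    images under [f], and chain lifting applies to these. *)
Lemma coarsely_monotoneP (X Y : lsSpace) (f : lsMap X Y) :
  coarsely_monotone f <->
  (exists h : Y -> X, close (f \o h) id) /\ chain_lifting f.
Proof.
have lsY := unif_bounded_ls Y; have lsf := unif_bounded_ls (light_space f).
split=> [[_ [h [ch hf fh]]]|[[h /closeP[Vh bVh nVh]] lift]].
  split; first by exists h.
  move=> V bV; have /closeP[U bU nU] := hf.
  have [U1 bU1 t1] := near_trans lsf bU (ch _ bV).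
  have [U2 bU2 t2] := near_trans lsf bU bU1.
  have [_ ax1 _] := lsf.
  have [A [B [bA bB r]]] := bU2.
  (* Singletons are added because a one-point set [C] need not lie in a member of
     [component_preimages f A B]. *)
  exists A, (with_points B); split=> // [|x x' nx]; first exact: ls_with_points.
  have [C UC [Cx Cx']] : near U2 x x'.
    apply: (t2 _ _ _ (near_sym (nU x))); apply: near_sym.
    apply: (t1 _ _ _ (near_sym (nU x'))); apply: near_image; exact: near_sym.
  by have [w Bw ch'] := refines_preimages r UC Cx; exists w => //; exact: ch'.
split.
  move=> F [U [V [bU bV r]]]; apply: (ls_pairwise lsY bV).
  move=> _ _ _ [B FB <-] [x Bx <-] [y By <-] ne.
  apply: (@light_near_near _ _ f U); apply/light_nearE.
  have [|A VA BA] := r _ FB.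
    by exists x, y; split=> // /(congr1 f).
  by exists A => //; split; [exact: BA Bx|exact: BA By].
exists h; split.
- move=> V bV.
  have [V1 bV1 t1] := near_trans lsY bVh bV.
  have [V2 bV2 t2] := near_trans lsY bV1 bVh.
  have [U [V' [bU bV' lV]]] := lift _ bV2.
  have bc := component_preimages_ub f bU bV'.
  refine (ls_pairwise lsf bc _).
  move=> _ _ _ [B VB <-] [y By <-] [y' By' <-] _; apply/light_nearE/lV.
  apply: t2 (near_sym (nVh y')); apply: t1 (nVh y) _.
  by exists B.
- have [U [V' [bU bV' lV]]] := lift _ bVh.
  apply/closeP; exists (component_preimages f U V').
    exact: component_preimages_ub.
  by move=> x; apply/light_nearE/lV; exact: nVh.
- by apply/closeP; exists Vh.
Qed.

(** Members of a light-bounded family are joined by chains of one bounded step, so the light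
    structure is contained in [I_structure X] and the same [h] serves as inverse. *)
Lemma coarsely_monotone_in_E_I (X Y : lsSpace) (f : lsMap X Y) :
  coarsely_monotone f -> in_E_I f.
Proof.
move=> cm; have [_ [h [ch hf fh]]] := cm.
have /coarsely_monotoneP[_ lift] := cm.
have lightI (F : set (set X)) :
    @unif_bounded (light_space f) F -> @unif_bounded (I_space X) F.
  move=> [U [V [bU bV r]]]; apply: I_structure_chained bU _ => B x y FB Bx By.
  have [w _ ch'] := refines_preimages r FB Bx.
  by apply: chained_mono (ch' _ _ Bx By).
have /lightI/chained_I_structure[U bU nU] := hf.
apply: (@in_E_I_section _ _ f h U) => // [V /ch/lightI //|x].
apply: nU; exists [set (h \o f) x; x]; first by exists x.
by split; [left|right].
Qed.

(** * Completing squares over a monogenic space *)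

Section Pullback.
Variables (X Y Z W : lsSpace) (f : lsMap X Y) (j : lsMap Z Y).
Variables (i : lsMap W X) (g : lsMap W Z).

Section Space.
Variables (h : Y -> X) (U : set (set X)) (V : set (set Y)).

(** A coarse pullback of [f] and [j]: the equation [f x = j z] is relaxed to a chain from [h (j z)]
    to [x]. *)
Definition chain_pullback : Type :=
  {p : X * Z | light_near f U V (h (j p.2)) p.1}.

Definition pullback_fst (p : chain_pullback) : X := (sval p).1.
Definition pullback_snd (p : chain_pullback) : Z := (sval p).2.

Definition pullback_space : lsSpace :=
  LsSpace (setI_ls (preimage_ls (unif_bounded_ls X) pullback_fst)
                   (preimage_ls (unif_bounded_ls Z) pullback_snd)).

Lemma pullback_fst_continuous : @ls_continuous pullback_space X pullback_fst.
Proof. by move=> F []. Qed.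

Lemma pullback_snd_continuous : @ls_continuous pullback_space Z pullback_snd.
Proof. by move=> F []. Qed.

(** The singletons let one coordinate rest while the other takes a step. *)
Definition pullback_steps (G : set (set Z)) : set (set chain_pullback) :=
  [set B | forall p q, B p -> B q ->
    near (with_points U) (pullback_fst p) (pullback_fst q) /\
    near (with_points G) (pullback_snd p) (pullback_snd q)].

Lemma pullback_steps_ub G : unif_bounded U -> unif_bounded G ->
  @unif_bounded pullback_space (pullback_steps G).
Proof.
have lsX := unif_bounded_ls X; have lsZ := unif_bounded_ls Z.
move=> bU bG; split.
  apply: (ls_pairwise lsX (ls_with_points lsX bU)).
  by move=> _ _ _ [B FB <-] [p Bp <-] [q Bq <-] _; have [] := FB _ _ Bp Bq.
apply: (ls_pairwise lsZ (ls_with_points lsZ bG)).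
by move=> _ _ _ [B FB <-] [p Bp <-] [q Bq <-] _; have [] := FB _ _ Bp Bq.
Qed.

Lemma near_pullback_steps G p q :
  near (with_points U) (pullback_fst p) (pullback_fst q) ->
  near (with_points G) (pullback_snd p) (pullback_snd q) ->
  near (pullback_steps G) p q.
Proof.
move=> n1 n2; exists [set p; q]; last by split; [left|right].
move=> _ _ [->|->] [->|->]; split=> //; try exact: near_with_points;
  exact: near_sym.
Qed.

(** Each point of the chain from [h (j z)] to [x] is the end of a shorter chain over the same member
    of [V], so the chain lifts to the pullback with [z] constant. *)
Lemma chained_pullback G z x (Hz : light_near f U V (h (j z)) (h (j z)))
    (Hx : light_near f U V (h (j z)) x) :
  chained (pullback_steps G) setT
    (exist _ (h (j z), z) Hz) (exist _ (x, z) Hx : chain_pullback).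
Proof.
have [v Vv ch] := Hx.
pose Q y := forall Hy : light_near f U V (h (j z)) y,
  chained (pullback_steps G) setT
    (exist _ (h (j z), z) Hz) (exist _ (y, z) Hy : chain_pullback).
apply: (chained_ind (Q := Q) _ _ ch Hx) => [Hy|a b cha IH vb Uab Hb].
  by rewrite (Prop_irrelevance Hy Hz); exact: chained_refl.
have Ha : light_near f U V (h (j z)) a by exists v.
apply: chained_trans (IH Ha) _; apply: chained_near => //.
apply: near_pullback_steps; last exact: near_with_points.
by apply: near_mono Uab; exact: sub_with_points.
Qed.

End Space.

Lemma coarsely_monotone_pullback :
  coarsely_monotone f -> monogenic Z -> close (f \o i) (j \o g) ->
  exists (P : lsSpace) (d : lsMap W P) (e : lsMap P Z) (c : lsMap P X),
    [/\ in_E_I e, close (j \o e) (f \o c), close (e \o d) g &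
        close (c \o d) i].
Proof.
move=> /coarsely_monotoneP[[h /closeP[Vh bVh nVh]] lift] [G [bG minG]].
move=> /closeP[Vi bVi nVi].
have lsX := unif_bounded_ls X; have lsY := unif_bounded_ls Y.
(* [V4] covers the path f (h (j z)), j z, j z', f (h (j z')) for z, z' near in [G]. *)
have [V3 bV3 t3] := near_trans lsY bVh (ls_fun_continuous j bG).
have [V4 bV4 t4] := near_trans lsY bV3 bVh.
have [U1 [V1 [bU1 bV1 lift1]]] := lift _ bV4.
have [V5 bV5 t5] := near_trans lsY bVi bVh.
have [U2 [V2 [bU2 bV2 lift2]]] := lift _ bV5.
(* One-point sets in [V] admit the constant chain at [h (j z)], which puts (h (j z), z) in the
   pullback. *)
pose U := U1 `|` U2; pose V := with_points (V1 `|` V2).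
have bU : unif_bounded U by exact: ls_union.
have bV : unif_bounded V by apply: ls_with_points => //; exact: ls_union.
have U1U : U1 `<=` U by move=> u; left.
have U2U : U2 `<=` U by move=> u; right.
have V1V : V1 `<=` V by move=> u ?; left; left.
have V2V : V2 `<=` V by move=> u ?; left; right.
have stepG z z' : near G z z' -> light_near f U V (h (j z)) (h (j z')).
  move=> Gzz'; apply: light_near_mono U1U V1V (lift1 _ _ _).
  apply: t4 (near_sym (nVh _)); apply: t3 (nVh _) _; exact: near_image.
have stepW w : light_near f U V (h (j (g w))) (i w).
  apply/light_near_sym/(light_near_mono U2U V2V)/lift2.
  exact: t5 (nVi _) (near_sym (nVh _)).
have sP z : light_near f U V (h (j z)) (h (j z)).
  exists [set f (h (j z))]; first by right; exists (f (h (j z))).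
  exact: chained_refl.
pose P := pullback_space h U V.
pose s z : P := exist _ (h (j z), z) (sP z).
pose d w : P := exist _ (i w, g w) (stepW w).
have cd : ls_continuous d.
  move=> F bF; split.
    apply: (ls_pairwise lsX (ls_fun_continuous i bF)).
    move=> _ _ _ [_ [B FB <-] <-] [_ [w Bw <-] <-] [_ [w' Bw' <-] <-] _.
    by apply: near_image; exists B.
  apply: (ls_pairwise (unif_bounded_ls Z) (ls_fun_continuous g bF)).
  move=> _ _ _ [_ [B FB <-] <-] [_ [w Bw <-] <-] [_ [w' Bw' <-] <-] _.
  by apply: near_image; exists B.
exists P, (LsMap cd), (LsMap (@pullback_snd_continuous h U V)),
  (LsMap (@pullback_fst_continuous h U V)).
have bS : @unif_bounded P (pullback_steps G) by exact: pullback_steps_ub.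
split.
- apply: (in_E_I_section (s := s) _ _ bS).
  (* The families with bounded image under [s] form an ls-structure, so by monogenicity only [G] has
     to be checked. *)
  + apply: (minG [set F | @unif_bounded (I_space P) [set s @` A | A in F]]).
      exact: (preimage_ls (unif_bounded_ls (I_space P)) s).
    apply: I_structure_chained bS _ => _ _ _ [B GB <-] [z Bz <-] [z' Bz' <-].
    have Gzz' : near G z z' by exists B.
    (* First move from (h (j z), z) to (h (j z'), z), then replace z by z' in one step. *)
    apply: chained_trans (chained_pullback G (sP z) (stepG _ _ Gzz')) _.
    apply: chained_near => //; apply: near_pullback_steps.
      exact: near_with_points.
    by apply: near_mono Gzz'; exact: sub_with_points.
  + exact: close_refl.
  + by move=> [[x z] Hp]; exact: chained_pullback.
- have [V6 bV6 t6] := near_trans lsY bVh bV.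
  apply/closeP; exists V6 => // -[[x z] Hp].
  exact: t6 (near_sym (nVh _)) (light_near_near Hp).
- exact: close_refl.
- exact: close_refl.
Qed.

End Pullback.

(** * Stability implies chain lifting *)

(** A chain whose steps stay inside fibers never changes fiber. *)
Lemma I_structure_fiber (X T : Type) (q : X -> T) (F : set (set X)) :
  @I_structure (fiber_space q) F -> fiber_structure q F.
Proof.
move=> /chained_I_structure[U bU nU] x y /nU.
apply: (chained_ind (Q := fun z => q x = q z)) => // a b _ -> _ Uab.
exact: bU.
Qed.

Section StableLifting.
Variables (X Y : lsSpace) (f : lsMap X Y).
Hypothesis f_stable : stably_in_E_I monogenic_domain f.
Variables (V : set (set Y)) (bV : unif_bounded V).

(** The disjoint union of the members of [V]: each point carries the member it is taken from. *)
Definition pieces : Type := {p : set Y * Y | V p.1 /\ p.1 p.2}.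
Definition piece (z : pieces) : set Y := (sval z).1.
Definition piece_point (z : pieces) : Y := (sval z).2.

Lemma piece_point_continuous : @ls_continuous (fiber_space piece) Y piece_point.
Proof.
move=> F bF; apply: (ls_pairwise (unif_bounded_ls Y) bV).
move=> _ _ _ [B FB <-] [a Ba <-] [b Bb <-] _.
have eab : piece a = piece b by apply: bF; exists B.
have [[Va aa] [_ bb]] := (svalP a, svalP b).
by exists (piece a) => //; split=> //; rewrite eab.
Qed.

Definition lifts : Type := {p : set Y * X | V p.1 /\ p.1 (f p.2)}.
Definition lift_point (w : fiber_space (@id lifts)) : X := (sval w).2.
Definition lift_piece (w : fiber_space (@id lifts)) : fiber_space piece :=
  exist _ ((sval w).1, f (sval w).2) (svalP w).

(** Stability completes the square formed by [lift_point] and [lift_piece]. The inverse [k] of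
    [I_map e] yields chains between points of [P] over the same piece, and [c] carries them to
    [X]. *)
Lemma stably_in_E_I_lifting : exists U V',
  [/\ unif_bounded U, unif_bounded V',
    forall v y, V v -> v y -> exists x, near V' (f x) y &
    forall v x x', V v -> v (f x) -> v (f x') -> light_near f U V' x x'].
Proof.
have lsX := unif_bounded_ls X; have lsY := unif_bounded_ls Y.
pose j := LsMap piece_point_continuous.
pose i := LsMap (ls_continuous_fiber lift_point).
pose g := LsMap (ls_continuous_fiber lift_piece).
have [] := f_stable.2 _ j (fiber_space_monogenic piece) _ i g.
  exact: close_refl.
move=> P [d [e [c [[_ [k [ck ke ek]]] /closeP[V1 bV1 nV1] ed]]]].
move=> /closeP[U1 bU1 nU1].
(* Closeness in a fiber structure is equality of pieces, so this identity and the next are exact. *)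
have piece_ek z : piece (e (k z)) = piece z.
  apply: (I_structure_fiber ek); exists [set e (k z); z]; first by exists z.
  by split; [left|right].
have piece_ed w : piece (e (d w)) = (sval w).1.
  apply: (ed _ (g w)); exists [set e (d w); g w]; first by exists w.
  by split; [left|right].
(* Each piece is bounded, so continuity of [k] gives one step size for chains joining [k z] to
   [k z'] within a piece. *)
pose G := [set [set z' | piece z' = piece z] | z in [set: pieces]].
have bG : @unif_bounded (I_space (fiber_space piece)) G.
  exists G; first by move=> x y [_ [z _ <-] /= [-> ->]].
  move=> _ [z _ <-] _; exists (component G setT z); first by exists z.
  move=> z' zz'; apply: chained_near => //.
  by exists [set z' | piece z' = piece z]; [exists z|].
have [U2 bU2 nU2] := chained_I_structure (ck _ bG).
have [U3 bU3 nU3] := chained_I_structure ke.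
have bU23 := ls_union (unif_bounded_ls P) bU2 bU3.
have ch w w' : (sval w).1 = (sval w').1 ->
    chained (U2 `|` U3) [set p | piece (e p) = (sval w).1] (d w) (d w').
  (* Continuity of [e] keeps every step over one piece, so it suffices to join d w, k (e (d w)), k
     (e (d w')), d w' by chains anywhere in [P]. *)
  move=> ww'; apply: chained_invariant; first exact: piece_ed.
    move=> a b Uab <-; apply: esym; apply: (ls_fun_continuous e bU23).
    exact: near_image.
  have ked p : chained (U2 `|` U3) setT (k (e p)) p.
    apply: (@chained_mono _ U3 _ setT) => //.
    apply: nU3; exists [set (k \o e) p; p]; first by exists p.
    by split; [left|right].
  apply: chained_trans (chained_sym (ked (d w))) _.
  apply: chained_trans (ked (d w')).
  apply: (@chained_mono _ U2 _ setT) => //.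
  apply: nU2; apply: near_image.
  exists [set z | piece z = piece (e (d w))]; first by exists (e (d w)).
  by split=> //=; rewrite !piece_ed.
have bc := ls_fun_continuous c bU23.
pose V' := star_family V (with_points V1).
have subV' v : v `<=` star v (with_points V1).
  by move=> y vy; exists [set y] => //=; split; [right; exists y|exists y].
have fcV' p : star (piece (e p)) (with_points V1) (f (c p)).
  have [u Vu [ju fu]] := nV1 p; exists u => //=; split; first by left.
  by exists (j (e p)); split=> //; have [] := svalP (e p).
(* [U1] provides the end steps from [c (d w)] to the given point; [V'] enlarges each piece so as to
   contain [f (c p)] for all [p] over it. *)
exists ([set c @` A | A in U2 `|` U3] `|` U1), V'; split.
- exact: ls_union.
- by have [_ _ ax2] := lsY; apply: ax2 => //; exact: ls_with_points.
- move=> v y Vv vy; pose z : pieces := exist _ (v, y) (conj Vv vy).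
  exists (c (k z)), (star v (with_points V1)); first by exists v.
  by split; [have := fcV' (k z); rewrite piece_ek|exact: subV'].
- move=> v x x' Vv vx vx'; exists (star v (with_points V1)); first by exists v.
  pose w : lifts := exist _ (v, x) (conj Vv vx).
  pose w' : lifts := exist _ (v, x') (conj Vv vx').
  have end_step (u : lifts) : (sval u).1 = v ->
      chained ([set c @` A | A in U2 `|` U3] `|` U1)
        (f @^-1` star v (with_points V1)) (c (d u)) (sval u).2.
    move=> uv; apply: chained_near.
    + by apply: near_mono (nU1 u); exact: subsetUr.
    + by have := fcV' (d u); rewrite piece_ed uv.
    + by apply: subV'; have [] := svalP u; rewrite uv.
  apply: chained_trans (chained_sym (end_step w erefl)) _.
  apply: chained_trans (end_step w' erefl).
  apply: chained_mono (chained_image c (ch w w' erefl)); first exact: subsetUl.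
  by move=> _ [p /= pv <-]; have := fcV' p; rewrite pv.
Qed.

End StableLifting.

Theorem theorem6p6 (X Y : lsSpace) (f : lsMap X Y) :
  coarsely_monotone f <-> stably_in_E_I monogenic_domain f.
Proof.
split=> [cm|stab].
  split; first exact: coarsely_monotone_in_E_I.
  by move=> Z j mZ W i g; exact: coarsely_monotone_pullback.
apply/coarsely_monotoneP; split.
  (* With one-point sets as pieces, the surjectivity clause says that [f] is coarsely surjective. *)
  have [U [V [_ bV surj _]]] :=
    stably_in_E_I_lifting stab (@points_unif_bounded Y).
  have /choice[h hV] y : exists x, near V (f x) y.
    by apply: (surj [set y]) => //; right; exists y.
  by exists h; apply/closeP; exists V.
move=> V bV; have [U [V' [bU bV' _ lift]]] := stably_in_E_I_lifting stab bV.
by exists U, V'; split=> // x x' [v Vv [vx vx']]; exact: lift vx vx'.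
Qed.
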